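(* Let $n\ge 3$ and let $W_{n+1}$ be the wheel graph with rim $C_n$. Then the chromatic curling number and the chromatic compound curling number of $W_{n+1}$ are equal to those of its rim, i.e. $cn_{\chi}(W_{n+1})=cn_{\chi}(C_n)$ and $cn^c_{\chi}(W_{n+1})=cn^c_{\chi}(C_n)$.
   Context: All graphs are finite, simple, undirected and connected. A chromatic colouring of a graph $G$ is a proper vertex colouring with exactly $\chi(G)$ colours $c_1,\ldots,c_\ell$, $\ell=\chi(G)$; the colour class of $c_i$ is denoted $\mathcal{C}_i$ and $\theta(c_i)=|\mathcal{C}_i|$. A $\chi^-$-colouring of $G$ is a chromatic colouring in which the maximum possible number of vertices gets colour $c_1$, then (subject to that) the maximum possible number of the remaining vertices gets $c_2$, then the maximum possible number of the remaining vertices gets $c_3$, and so on; that is, $(\theta(c_1),\ldots,\theta(c_\ell))$ is lexicographically maximal among all chromatic colourings of $G$. With respect to a $\chi^-$-colouring, the chromatic curling number is $cn_{\chi}(G)=\max\{\theta(c_i):1\le i\le \ell\}$ and the chromatic compound curling number is $cn^c_{\chi}(G)=\prod_{i=1}^{\ell}\theta(c_i)$. The wheel graph $W_{n+1}$ is obtained by joining all vertices of a cycle $C_n$ (the rim) to one external vertex (the central vertex). *)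

(* Defs.v *)
From mathcomp Require Import all_boot all_order.

Set Implicit Arguments.
Unset Strict Implicit.
Unset Printing Implicit Defensive.

Record sgraph := SGraph {
  vertex :> finType;
  adj : rel vertex;
  adj_sym : symmetric adj;
  adj_irrefl : irreflexive adj
}.

Section Colouring.
Variable G : sgraph.

Definition proper_colouring k (f : {ffun G -> 'I_k}) : bool :=
  [forall u, forall v, adj u v ==> (f u != f v)].

Definition colourable k : bool := [exists f : {ffun G -> 'I_k}, proper_colouring f].

Lemma colourable_ex : exists k, colourable k.
Proof.
exists #|G|; apply/existsP; exists [ffun v => enum_rank v].
apply/forallP=> u; apply/forallP=> v; apply/implyP=> uv; rewrite !ffunE.
by apply/eqP=> /enum_rank_inj euv; rewrite euv adj_irrefl in uv.
Qed.

Definition chi : nat := ex_minn colourable_ex.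

Definition chromatic (f : {ffun G -> 'I_chi}) : bool :=
  proper_colouring f && [forall c, exists v, f v == c].

Definition theta k (f : {ffun G -> 'I_k}) (c : 'I_k) : nat :=
  #|[set v | f v == c]|.

(* The type n.-tuplelexi nat carries the lexicographic order. *)
Definition thetas k (f : {ffun G -> 'I_k}) : k.-tuplelexi nat :=
  [tuple theta f c | c < k].

Definition chi_minus (f : {ffun G -> 'I_chi}) : bool :=
  chromatic f && [forall g, chromatic g ==> (thetas g <= thetas f)%O].

Lemma chromatic_ex : exists f, chromatic f.
Proof.
rewrite /chromatic /chi; case: ex_minnP => k /existsP[f pf] kmin.
exists f; rewrite pf; apply/forallP=> c; apply: contraT => /existsPn fc.
case: k => [|k] in f pf kmin c fc *; first by case: c {fc}.
suff /kmin : colourable k by rewrite ltnn.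
have /fin_all_exists[h hE] v : exists d, f v = lift c d.
  have cv : c != f v by rewrite eq_sym; apply: fc.
  by case/unlift_some: cv => d ->; exists d.
apply/existsP; exists [ffun v => h v].
apply/forallP=> u; apply/forallP=> v; apply/implyP=> uv; rewrite !ffunE.
have := implyP (forallP (forallP pf u) v) uv.
by rewrite !hE; apply: contra => /eqP->.
Qed.

Lemma chi_minus_ex : exists f, chi_minus f.
Proof.
have [f0 cf0] := chromatic_ex.
case: (Order.TotalTheory.arg_maxP (fun f => thetas f) cf0) => f cf fmax.
exists f; rewrite /chi_minus cf; apply/forallP=> g; apply/implyP; exact: fmax.
Qed.

(* Antisymmetry of the lexicographic order: the class sizes, hence both
   curling numbers, do not depend on the choice of a chi_minus colouring. *)
Lemma chi_minus_theta f g : chi_minus f -> chi_minus g -> theta f =1 theta g.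
Proof.
move=> /andP[cf /forallP fmax] /andP[cg /forallP gmax] c.
have /(congr1 (fun t => tnth t c)) : thetas f = thetas g.
  apply/Order.POrderTheory.le_anti.
  by rewrite (implyP (gmax f) cf) (implyP (fmax g) cg).
by rewrite !tnth_mktuple.
Qed.

Definition chi_minus_colouring : {ffun G -> 'I_chi} := xchoose chi_minus_ex.

Definition cn_chi : nat := \max_c theta chi_minus_colouring c.

Definition cnc_chi : nat := \prod_c theta chi_minus_colouring c.

End Colouring.

Section Cycle.
Variable n : nat.

(* ordS is the cyclic successor; the disequality only matters for n = 1,
   where it rules out a loop. *)
Definition cycle_adj : rel 'I_n :=
  fun i j => (i != j) && ((j == ordS i) || (i == ordS j)).

Lemma cycle_adj_sym : symmetric cycle_adj.
Proof. by move=> i j; rewrite /cycle_adj eq_sym orbC. Qed.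

Lemma cycle_adj_irrefl : irreflexive cycle_adj.
Proof. by move=> i; rewrite /cycle_adj eqxx. Qed.

Definition cycle_graph : sgraph := SGraph cycle_adj_sym cycle_adj_irrefl.

End Cycle.

Section Cone.
Variable G : sgraph.

Definition cone_adj : rel (option G) := fun x y =>
  match x, y with
  | Some u, Some v => adj u v
  | None, None => false
  | _, _ => true
  end.

Lemma cone_adj_sym : symmetric cone_adj.
Proof. by case=> [u|] [v|] //=; apply: adj_sym. Qed.

Lemma cone_adj_irrefl : irreflexive cone_adj.
Proof. by case=> [u|] //=; apply: adj_irrefl. Qed.

Definition cone : sgraph := SGraph cone_adj_sym cone_adj_irrefl.

End Cone.

(* Indexed by the rim length: wheel_graph n has n.+1 vertices, and None is the
   central vertex. *)
Definition wheel_graph (n : nat) : sgraph := cone (cycle_graph n).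

(* Main.v *)
(**
The centre of a cone is adjacent to every other vertex, so a proper colouring
of [cone G] is a proper colouring of [G] together with a fresh colour used only
at the centre. Inserting the entry 1 in a vector of positive integers gives the
lexicographically largest result at the last position, so the optimal class
sizes of [cone G] are those of [G] followed by a final 1, which changes neither
the maximum (if [G] has a vertex) nor the product.
*)
Require Import Defs.
From mathcomp Require Import all_boot.
From mathcomp Require Import order.

Set Implicit Arguments.
Unset Strict Implicit.
Unset Printing Implicit Defensive.

Import Order.TTheory.

Section Lexicographic.
Local Open Scope order_scope.

(** At the head, 1 faces an entry [x >= 1]. Either [x > 1] settles the comparison, or [x = 1] is a
    tie and the tails pose the same question for a shorter sequence. *)
Lemma seqlexi_cons_le_rcons (s : seqlexi nat) :
  all (leq 1) s -> (1%N :: s : seqlexi nat) <= rcons s 1%N.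
Proof.
elim: s => [|x s IHs] //= /andP[x1 s1].
rewrite lexi_cons leEnat x1 /=; apply/implyP => x_le1.
have -> : x = 1%N by apply/eqP; rewrite eqn_leq x_le1.
exact: IHs.
Qed.

Lemma seqlexi_cat2l (r s t : seqlexi nat) :
  (r ++ s : seqlexi nat) <= r ++ t = (s <= t).
Proof. by elim: r => //= x r IHr; rewrite lexi_cons lexx /= IHr. Qed.

(** Equal sizes matter: [[::] <= [:: 0]], but appending 1 to both sides reverses the comparison. *)
Lemma seqlexi_rcons x (s t : seqlexi nat) : size s = size t -> s <= t ->
  (rcons s x : seqlexi nat) <= rcons t x.
Proof.
elim: s t => [|y s IHs] [|z t] //= [st]; rewrite !lexi_cons => /andP[-> /=].
by move/implyP=> le_st; apply/implyP=> /le_st; apply: IHs.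
Qed.

End Lexicographic.

(** This is [chromatic] with the number of colours left free; at [k = chi G] the two are
    convertible. *)
Definition surjective_proper (G : sgraph) k (f : {ffun G -> 'I_k}) :=
  proper_colouring f && [forall c, exists v, f v == c].

Lemma proper_colouringP (G : sgraph) k (f : {ffun G -> 'I_k}) :
  reflect (forall u v, adj u v -> f u != f v) (proper_colouring f).
Proof.
apply: (iffP forallP) => [pf u v uv|pf u]; last first.
  by apply/forallP => v; apply/implyP; apply: pf.
by have /forallP/(_ v)/implyP := pf u; apply.
Qed.

Lemma theta_gt0 (G : sgraph) k (f : {ffun G -> 'I_k}) v : 0 < theta f (f v).
Proof. by rewrite card_gt0; apply/set0Pn; exists v; rewrite inE. Qed.

Lemma size_thetas (G : sgraph) k (f : {ffun G -> 'I_k}) : size (thetas f) = k.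
Proof. exact: size_tuple. Qed.

Lemma nth_thetas (G : sgraph) k (f : {ffun G -> 'I_k}) (c : 'I_k) :
  nth 0 (thetas f) c = theta f c.
Proof. by rewrite -tnth_nth tnth_mktuple. Qed.

Lemma thetas_gt0 (G : sgraph) k (f : {ffun G -> 'I_k}) :
  surjective_proper f -> all (leq 1) (thetas f).
Proof.
case/andP=> _ /forallP sf; apply/allP=> _ /mapP[c _ ->].
by have /existsP[v /eqP <-] := sf c; apply: theta_gt0.
Qed.

(* Trades the dependent type ['I_(chi G)] for a colour type of the caller's choice. *)
Lemma curling_optimal (G : sgraph) k (f : {ffun G -> 'I_k}) :
    chi G = k -> surjective_proper f ->
    (forall g : {ffun G -> 'I_k}, surjective_proper g ->
       (thetas g <= thetas f)%O) ->
  cn_chi G = \max_c theta f c /\ cnc_chi G = \prod_c theta f c.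
Proof.
move=> chiG; move: f; case: k / chiG => f cf fmax.
have fm : chi_minus f.
  by apply/andP; split=> //; apply/forallP=> g; apply/implyP; apply: fmax.
have th := chi_minus_theta (xchooseP (chi_minus_ex G)) fm.
by split; apply: eq_bigr => c _; apply: th.
Qed.

Section ConeColouring.
Variable G : sgraph.

(** [lift c0] is the increasing embedding that misses [c0], so the classes of [f] keep their
    relative order. *)
Definition cone_colouring k (c0 : 'I_k.+1) (f : {ffun G -> 'I_k}) :
    {ffun cone G -> 'I_k.+1} :=
  [ffun x : option G => if x is Some v then lift c0 (f v) else c0].

Lemma proper_cone_colouring k (c0 : 'I_k.+1) (f : {ffun G -> 'I_k}) :
  proper_colouring (cone_colouring c0 f) = proper_colouring f.
Proof.
apply/proper_colouringP/proper_colouringP=> pf.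
  move=> u v uv; have := pf (Some u) (Some v) uv.
  by rewrite !ffunE (inj_eq lift_inj).
case=> [u|] [v|] //= uv; rewrite !ffunE.
- by rewrite (inj_eq lift_inj); apply: pf.
- by rewrite eq_sym neq_lift.
- by rewrite neq_lift.
Qed.

Lemma surjective_cone_colouring k (c0 : 'I_k.+1) (f : {ffun G -> 'I_k}) :
  surjective_proper (cone_colouring c0 f) = surjective_proper f.
Proof.
rewrite /surjective_proper proper_cone_colouring; congr (_ && _).
apply/forallP/forallP=> sf c.
  have /existsP[[v|]] := sf (lift c0 c); rewrite ffunE.
    by rewrite (inj_eq lift_inj) => fv; apply/existsP; exists v.
  by rewrite (negPf (neq_lift c0 c)).
case: (unliftP c0 c) => [d ->|->].
  have /existsP[v /eqP fv] := sf d.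
  by apply/existsP; exists (Some v); rewrite ffunE fv.
by apply/existsP; exists None; rewrite ffunE.
Qed.

(** Every other vertex is adjacent to the centre and so avoids its colour [c0]; its colour therefore
    lies in the image of [lift c0]. *)
Lemma cone_colouring_surj k (g : {ffun cone G -> 'I_k.+1}) :
  proper_colouring g -> exists c0 f, g = cone_colouring c0 f.
Proof.
move=> /proper_colouringP pg; pose c0 := g None.
have /fin_all_exists[h hE] (v : G) : exists d, g (Some v) = lift c0 d.
  have gv : c0 != g (Some v) by apply: pg.
  by case/unlift_some: gv => d ->; exists d.
exists c0, [ffun v => h v]; apply/ffunP=> -[v|]; rewrite ffunE //.
by rewrite ffunE hE.
Qed.

Lemma theta_cone_centre k (c0 : 'I_k.+1) (f : {ffun G -> 'I_k}) :
  theta (cone_colouring c0 f) c0 = 1.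
Proof.
rewrite /theta (_ : [set v | _] = [set None]) ?cards1 //.
apply/setP=> -[v|]; rewrite !inE ffunE ?eqxx //.
by rewrite eq_sym (negPf (neq_lift _ _)).
Qed.

Lemma theta_cone_lift k (c0 : 'I_k.+1) (f : {ffun G -> 'I_k}) c :
  theta (cone_colouring c0 f) (lift c0 c) = theta f c.
Proof.
rewrite /theta -[RHS](card_imset _ Some_inj); apply: eq_card => -[v|].
  by rewrite (mem_imset _ _ Some_inj) !inE ffunE (inj_eq lift_inj).
rewrite !inE ffunE (negPf (neq_lift _ _)); apply/esym/imsetP.
by case=> v.
Qed.

Lemma thetas_cone k (c0 : 'I_k.+1) (f : {ffun G -> 'I_k}) :
  thetas (cone_colouring c0 f) = take c0 (thetas f) ++ 1 :: drop c0 (thetas f)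
    :> seq nat.
Proof.
have le_c0k : c0 <= k by rewrite -ltnS.
have sz : size (take c0 (thetas f)) = c0 by rewrite size_takel ?size_thetas.
apply: (@eq_from_nth _ 0) => [|i].
  by rewrite size_cat sz /= size_drop !size_thetas addnS subnKC.
rewrite size_thetas => lt_ik; rewrite -[i]/(nat_of_ord (Ordinal lt_ik)).
move: (Ordinal lt_ik) => c; rewrite nth_thetas.
case: (unliftP c0 c) => [d ->|->]; last first.
  by rewrite theta_cone_centre nth_cat sz ltnn subnn.
(* Colours below [c0] keep their index; those from [c0] on move up by one, past the inserted 1. *)
rewrite theta_cone_lift -nth_thetas nth_cat sz /= /bump.
case: (leqP c0 d) => [le_c0d|lt_dc0]; last by rewrite add0n lt_dc0 nth_take.
by rewrite ltnNge leqW //= subSn //= nth_drop subnKC.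
Qed.

Lemma thetas_cone_max k (f : {ffun G -> 'I_k}) :
  thetas (cone_colouring ord_max f) = rcons (thetas f) 1 :> seq nat.
Proof.
rewrite thetas_cone take_oversize ?size_thetas // drop_oversize ?size_thetas //.
by rewrite cats1.
Qed.

Lemma thetas_cone_le k (c0 : 'I_k.+1) (f : {ffun G -> 'I_k}) :
  surjective_proper f ->
  (thetas (cone_colouring c0 f) <= thetas (cone_colouring ord_max f))%O.
Proof.
move=> /thetas_gt0 f_gt0.
(* The order on tuples is by conversion that of the underlying sequences, which can be split at
   [c0]. *)
change ((thetas (cone_colouring c0 f) : seqlexi nat) <=
        (thetas (cone_colouring ord_max f) : seqlexi nat))%O.
rewrite thetas_cone_max thetas_cone.
rewrite -[in rcons _ _](cat_take_drop c0 (thetas f)) rcons_cat.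
rewrite seqlexi_cat2l seqlexi_cons_le_rcons //.
by apply/allP=> x /mem_drop; apply/allP.
Qed.

Lemma thetas_cone_mono k (f g : {ffun G -> 'I_k}) :
  (thetas f <= thetas g)%O ->
  (thetas (cone_colouring ord_max f) <= thetas (cone_colouring ord_max g))%O.
Proof.
move=> le_fg.
change ((thetas (cone_colouring ord_max f) : seqlexi nat) <=
        (thetas (cone_colouring ord_max g) : seqlexi nat))%O.
by rewrite !thetas_cone_max seqlexi_rcons // !size_thetas.
Qed.

Lemma colourable_cone k : colourable (cone G) k.+1 = colourable G k.
Proof.
apply/existsP/existsP=> [[g pg]|[f pf]].
  have [c0 [f gE]] := cone_colouring_surj pg.
  by exists f; rewrite gE proper_cone_colouring in pg.
by exists (cone_colouring ord0 f); rewrite proper_cone_colouring.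
Qed.

Lemma chi_cone : chi (cone G) = (chi G).+1.
Proof.
rewrite /chi; case: ex_minnP => m colm minm; case: ex_minnP => k colk mink.
(* The centre needs a colour, so [m] is not 0. *)
case: m => [|m] in colm minm *.
  by case/existsP: colm => g _; case: (g None).
apply/eqP; rewrite eqn_leq minm ?colourable_cone //=.
by apply: mink; rewrite -colourable_cone.
Qed.

(** The vertex [v] makes some class of [G] at least as large as the class of the centre; without
    vertices the maxima would be 1 and 0. *)
Lemma curling_cone (v : G) :
  cn_chi (cone G) = cn_chi G /\ cnc_chi (cone G) = cnc_chi G.
Proof.
rewrite [cn_chi G]/cn_chi [cnc_chi G]/cnc_chi; set f := chi_minus_colouring G.
have /andP[cf /forallP fmax] : chi_minus f := xchooseP (chi_minus_ex G).
have [||-> ->] := curling_optimal (f := cone_colouring ord_max f) chi_cone.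
- by rewrite surjective_cone_colouring.
(* Two improvements lead from [g] to the candidate: first give the centre the last colour, then
   replace [h] by the optimal [f]. *)
- move=> g cg; have /andP[/cone_colouring_surj[c0 [h gE]] _] := cg.
  rewrite gE surjective_cone_colouring in cg *.
  apply: le_trans (thetas_cone_le c0 cg) _.
  by apply: thetas_cone_mono; apply: implyP (fmax h) cg.
have widenE i : widen_ord (leqnSn (chi G)) i = lift ord_max i.
  by apply/val_inj/esym/lift_max.
(* Splitting off the last colour isolates the class of the centre. *)
rewrite !big_ord_recr /= theta_cone_centre muln1.
under eq_bigr do rewrite widenE theta_cone_lift.
split; last by apply: eq_bigr => i _; rewrite widenE theta_cone_lift.
by apply/maxn_idPl; apply: leq_trans (theta_gt0 f v) (leq_bigmax _).
Qed.

End ConeColouring.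

Theorem theorem2 (n : nat) (hn : 3 <= n) :
  cn_chi (wheel_graph n) = cn_chi (cycle_graph n) /\
  cnc_chi (wheel_graph n) = cnc_chi (cycle_graph n).
Proof.
(* Rim vertex 0 serves as the required vertex. *)
apply: curling_cone (Ordinal _ : cycle_graph n).
exact: ltnW (ltnW hn).
Qed.
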